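(* If $(\mathcal{I}_{BLip},\|\cdot\|_{\mathcal{I}_{BLip}})$ is a normed (respectively, Banach) two-Lipschitz operator ideal, then its two-Lipschitz injective hull $\mathcal{I}_{BLip}^{inj}$ together with $\|\cdot\|_{\mathcal{I}_{BLip}^{inj}}$ is a normed (respectively, Banach) two-Lipschitz operator ideal.
   Context: Let $\mathbb{K}$ be $\mathbb{R}$ or $\mathbb{C}$; all Banach spaces are over $\mathbb{K}$. A pointed metric space is a metric space with a distinguished base point $0$. $Lip_0(X,Y)$ is the set of Lipschitz maps $T:X\to Y$ with $T(0)=0$, $Lip(T)$ is the least Lipschitz constant, and $X^{\#}=Lip_0(X,\mathbb{K})$. $\mathcal{L}(E,F)$ is the space of bounded linear operators. Two-Lipschitz operators: a map $T:X_1\times X_2\to E$ ($X_1,X_2$ pointed metric spaces, $E$ Banach) belongs to $BLip_0(X_1,X_2;E)$ if $T(x_1,0)=T(0,x_2)=0$ for all $x_1,x_2$ and there is $C>0$ with $\|T(x_1,x_2)-T(x_1,x_2')-T(x_1',x_2)+T(x_1',x_2')\|\le C\,d(x_1,x_1')d(x_2,x_2')$ for all $x_1,x_1'\in X_1$, $x_2,x_2'\in X_2$. The least such $C$ is $BLip(T)$; this is a Banach space norm on $BLip_0(X_1,X_2;E)$. A two-Lipschitz operator ideal $\mathcal{I}_{BLip}$ is a subclass of $BLip_0$ such that for all pointed metric spaces $X_1,X_2$ and Banach spaces $E$ the components $\mathcal{I}_{BLip}(X_1,X_2;E):=BLip_0(X_1,X_2;E)\cap\mathcal{I}_{BLip}$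 satisfy: (i) $\mathcal{I}_{BLip}(X_1,X_2;E)$ is a linear subspace of $BLip_0(X_1,X_2;E)$; (ii) for $f_1\in X_1^{\#}$, $f_2\in X_2^{\#}$, $e\in E$, the map $f_1\cdot f_2\cdot e:(x_1,x_2)\mapsto f_1(x_1)f_2(x_2)e$ belongs to $\mathcal{I}_{BLip}(X_1,X_2;E)$; (iii) if $f_1\in Lip_0(Z,X_1)$, $f_2\in Lip_0(W,X_2)$, $T\in\mathcal{I}_{BLip}(X_1,X_2;E)$ and $u\in\mathcal{L}(E,F)$, then $u\circ T\circ(f_1,f_2)\in\mathcal{I}_{BLip}(Z,W;F)$. It is a normed (Banach) two-Lipschitz operator ideal if there is $\|\cdot\|_{\mathcal{I}_{BLip}}:\mathcal{I}_{BLip}\to[0,\infty)$ such that (i') each $(\mathcal{I}_{BLip}(X_1,X_2;E),\|\cdot\|_{\mathcal{I}_{BLip}})$ is a normed (Banach) space and $BLip(T)\le\|T\|_{\mathcal{I}_{BLip}}$; (ii') $Id_{\mathbb{K}^2}:\mathbb{K}\times\mathbb{K}\to\mathbb{K}$, $(\alpha,\beta)\mapsto\alpha\beta$, has $\|Id_{\mathbb{K}^2}\|_{\mathcal{I}_{BLip}}=1$; (iii') in the situation of (iii), $\|u\circ T\circ(f_1,f_2)\|_{\mathcal{I}_{BLip}}\le\|u\|\,\|T\|_{\mathcal{I}_{BLip}}Lip(f_1)Lip(f_2)$. For a Banach space $E$, $B_{E^*}$ is the closed unit ball of $E^*$ and $J_E:E\to\ell_\infty(B_{E^*})$ is $J_E(y)=(\langle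 y,y^*\rangle)_{y^*\in B_{E^*}}$. The two-Lipschitz injective hull $\mathcal{I}_{BLip}^{inj}$ is defined by: $T\in BLip_0(X_1,X_2;E)$ belongs to $\mathcal{I}_{BLip}^{inj}(X_1,X_2;E)$ iff $J_E\circ T\in\mathcal{I}_{BLip}(X_1,X_2;\ell_\infty(B_{E^*}))$; and $\|T\|_{\mathcal{I}_{BLip}^{inj}}:=\|J_E\circ T\|_{\mathcal{I}_{BLip}}$. *)

(* Defs.v *)
From Stdlib Require Import Reals Lra Classical ClassicalEpsilon.
From Stdlib Require Import FunctionalExtensionality PropExtensionality ProofIrrelevance.
From Coquelicot Require Export Coquelicot.
From Stdlib Require Export Reals.
Open Scope R_scope.

(* Coquelicot asks for a total limit operator; it is obtained by choice from
   the convergence of Cauchy filters. *)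
Definition cauchy_converge (T : UniformSpace) : Prop :=
  forall F : (T -> Prop) -> Prop, ProperFilter F -> cauchy F ->
  exists l : T, forall eps : posreal, F (ball l eps).

Definition choice_lim (T : UniformSpace) (F : (T -> Prop) -> Prop) : T :=
  epsilon (inhabits (UniformSpace.point_of _ (UniformSpace.class T)))
    (fun l : T => forall eps : posreal, F (ball l eps)).

Definition complete_mixin (T : UniformSpace) (H : cauchy_converge T) :
  CompleteSpace.mixin_of T.
Proof.
apply (CompleteSpace.Mixin T (choice_lim T)).
- intros F HF HC.
  exact (epsilon_spec _ (fun l : T => forall eps : posreal, F (ball l eps))
           (H F HF HC)).
- intros F1 F2 H12 H21.
  replace F2 with F1.
  + intros eps; apply ball_center.
  + apply functional_extensionality; intros P; apply propositional_extensionality.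
    split; [apply H21 | apply H12].
Defined.

Variant scalar_field : Set := real_field | complex_field.

Definition scalars (k : scalar_field) : AbsRing :=
  match k with real_field => R_AbsRing | complex_field => C_AbsRing end.

Coercion scalars : scalar_field >-> AbsRing.type.

Lemma scalars_cauchy_converge (k : scalar_field) :
  cauchy_converge (AbsRing_UniformSpace k).
Proof.
destruct k; simpl.
- intros F HF HC.
  exists (@lim R_CompleteSpace F).
  exact (@complete_cauchy R_CompleteSpace F HF HC).
- intros F HF HC.
  assert (HC' : @cauchy C_UniformSpace F).
  { intros eps.
    destruct (HC eps) as [x Hx]; exists x.
    revert Hx; apply filter_imp; intros y Hy.
    exact (@norm_compat1 C_AbsRing C_NormedModule x y eps Hy). }
  pose (l := @lim C_CompleteNormedModule F); exists l; intros eps.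
  pose proof (@norm_factor_gt_0 C_AbsRing C_NormedModule) as Hn.
  set (nf := @norm_factor C_AbsRing C_NormedModule) in Hn.
  assert (He : 0 < eps / nf) by (apply Rdiv_lt_0_compat; [apply cond_pos | exact Hn]).
  pose proof (@complete_cauchy C_CompleteNormedModule F HF HC' (mkposreal _ He)) as Hl.
  revert Hl; apply filter_imp; intros y Hy.
  pose proof (@norm_compat2 C_AbsRing C_NormedModule l y (mkposreal _ He) Hy) as Hlt.
  simpl in Hlt; fold nf in Hlt.
  replace (nf * (eps / nf)) with (pos eps) in Hlt by (field; lra).
  exact Hlt.
Qed.

(* Packed by hand rather than by cases on R_CompleteNormedModule and
   C_CompleteNormedModule, so that the carrier is definitionally k and the norm
   is definitionally abs. *)
Definition scalar_space (k : scalar_field) : CompleteNormedModule k :=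
  CompleteNormedModule.Pack k (AbsRing.sort k)
    (CompleteNormedModule.Class k (AbsRing.sort k)
       (NormedModule.class k (AbsRing_NormedModule k))
       (complete_mixin _ (scalars_cauchy_converge k)))
    (AbsRing.sort k).

Coercion Base : Metric_Space >-> Sortclass.

Record pointed_metric : Type := {
  pm_metric :> Metric_Space;
  base_point : pm_metric }.

Definition normed_metric {K : AbsRing} (V : NormedModule K) : Metric_Space.
Proof.
refine (Build_Metric_Space V (fun x y => norm (minus x y)) _ _ _ _).
- intros x y; apply Rle_ge, norm_ge_0.
- intros x y; rewrite <- (norm_opp (minus x y)), opp_minus; reflexivity.
- intros x y; split; intros H.
  + apply (plus_reg_r (opp y)); rewrite plus_opp_r.
    exact (norm_eq_zero _ H).
  + subst y; rewrite minus_eq_zero; exact norm_zero.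
- intros x y z; rewrite (minus_trans z x y); apply norm_triangle.
Defined.

Definition normed_pointed {K : AbsRing} (V : NormedModule K) : pointed_metric :=
  {| pm_metric := normed_metric V; base_point := (zero : V) |}.

Definition scalar_pointed (k : scalar_field) : pointed_metric :=
  normed_pointed (AbsRing_NormedModule k).

(* Taken as an infimum, so that it is total; for the Lipschitz bounds below the
   infimum is attained. *)
Definition least_constant (P : R -> Prop) : R :=
  real (Glb_Rbar (fun C => 0 <= C /\ P C)).

Definition lip_bound {X Y : pointed_metric} (f : X -> Y) (C : R) : Prop :=
  forall x x' : X, dist Y (f x) (f x') <= C * dist X x x'.

Definition Lip0 {X Y : pointed_metric} (f : X -> Y) : Prop :=
  f (base_point X) = base_point Y /\ exists C : R, 0 <= C /\ lip_bound f C.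

Definition Lip {X Y : pointed_metric} (f : X -> Y) : R :=
  least_constant (lip_bound f).

Definition Lip_dual {k : scalar_field} (X : pointed_metric) (f : X -> k) : Prop :=
  Lip0 (X := X) (Y := scalar_pointed k) f.

Definition two_lip_bound {K : AbsRing} {X1 X2 : pointed_metric}
    {E : CompleteNormedModule K} (T : X1 -> X2 -> E) (C : R) : Prop :=
  forall (x1 x1' : X1) (x2 x2' : X2),
  norm (plus (minus (minus (T x1 x2) (T x1 x2')) (T x1' x2)) (T x1' x2'))
    <= C * dist X1 x1 x1' * dist X2 x2 x2'.

Definition BLip0 {K : AbsRing} {X1 X2 : pointed_metric}
    {E : CompleteNormedModule K} (T : X1 -> X2 -> E) : Prop :=
  (forall x1 : X1, T x1 (base_point X2) = zero) /\
  (forall x2 : X2, T (base_point X1) x2 = zero) /\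
  exists C : R, 0 < C /\ two_lip_bound T C.

Definition BLip {K : AbsRing} {X1 X2 : pointed_metric}
    {E : CompleteNormedModule K} (T : X1 -> X2 -> E) : R :=
  least_constant (two_lip_bound T).

Definition op_norm {K : AbsRing} {E F : NormedModule K} (u : E -> F) : R :=
  real (Lub_Rbar (fun r => exists x : E, norm x <= 1 /\ r = norm (u x))).

(* [is_linear] includes boundedness, so these are elements of the dual of E. *)
Definition dual_ball {k : scalar_field} (E : NormedModule k) : Type :=
  { phi : E -> AbsRing_NormedModule k | is_linear phi /\ op_norm phi <= 1 }.

Lemma Lub_Rbar_bounded (P : R -> Prop) (M : R) :
  (exists r, P r) -> (forall r, P r -> r <= M) ->
  (forall r, P r -> r <= real (Lub_Rbar P)) /\ real (Lub_Rbar P) <= M.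
Proof.
intros [r0 H0] HM.
destruct (Lub_Rbar_correct P) as [Hub Hlub].
assert (HleM : Rbar_le (Lub_Rbar P) M) by (apply Hlub; intros r Hr; exact (HM r Hr)).
pose proof (Hub _ H0) as Hr0.
destruct (Lub_Rbar P) as [l | |]; simpl in *; [ | contradiction | contradiction].
split; [ intros r Hr; exact (Hub _ Hr) | exact HleM ].
Qed.

Lemma scalars_of_pos (k : scalar_field) (r : R) : 0 < r ->
  exists a b : k, mult a b = one /\ abs a = r /\ abs b = / r.
Proof.
intros Hr; destruct k; simpl.
- exists r, (/ r); split; [apply Rinv_r; lra | ].
  assert (0 < / r) by (apply Rinv_0_lt_compat; exact Hr).
  split; apply Rabs_right; lra.
- exists (RtoC r), (RtoC (/ r)); split.
  + change (Cmult (RtoC r) (RtoC (/ r)) = RtoC 1).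
    rewrite <- RtoC_mult; f_equal; apply Rinv_r; lra.
  + assert (0 < / r) by (apply Rinv_0_lt_compat; exact Hr).
    change (Cmod (RtoC r) = r /\ Cmod (RtoC (/ r)) = / r).
    rewrite !Cmod_R; split; apply Rabs_right; lra.
Qed.

Lemma op_norm_ub {k : scalar_field} {E F : NormedModule k} (u : E -> F) (x : E) :
  is_linear u -> norm (u x) <= op_norm u * norm x.
Proof.
intros Hu.
destruct (Rle_lt_or_eq_dec _ _ (norm_ge_0 x)) as [Hx | Hx].
- destruct (scalars_of_pos k (norm x) Hx) as [a [b [Hab [Ha Hb]]]].
  assert (Hbx : norm (scal b x) <= 1).
  { eapply Rle_trans; [apply norm_scal | ].
    change (abs b * norm x <= 1); rewrite Hb; apply Req_le; field; lra. }
  assert (Hub : norm (u (scal b x)) <= op_norm u).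
  { destruct (linear_norm _ Hu) as [M [HM Hbd]].
    apply (Lub_Rbar_bounded _ M).
    - exists (norm (u (scal b x))), (scal b x); split; [exact Hbx | reflexivity].
    - intros r [y [Hy ->]]; specialize (Hbd y).
      assert (M * norm y <= M * 1) by (apply Rmult_le_compat_l; lra); lra.
    - exists (scal b x); split; [exact Hbx | reflexivity]. }
  replace (u x) with (scal a (u (scal b x))).
  + eapply Rle_trans; [apply norm_scal | ].
    change (abs a * norm (u (scal b x)) <= op_norm u * norm x).
    rewrite Ha, Rmult_comm; apply Rmult_le_compat_r; [apply norm_ge_0 | exact Hub].
  + rewrite (linear_scal _ Hu), scal_assoc, Hab; apply scal_one.
- rewrite <- Hx, Rmult_0_r.
  destruct (linear_norm _ Hu) as [M [_ Hbd]]; specialize (Hbd x).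
  rewrite <- Hx, Rmult_0_r in Hbd; exact Hbd.
Qed.

Section LInfty.

Context (k : scalar_field) (I : Type).

Record linf : Type := Linf {
  linf_fun :> I -> k;
  linf_bounded : exists M : R, forall i, abs (linf_fun i) <= M }.

Lemma linf_eq (f g : linf) : (forall i, f i = g i) -> f = g.
Proof.
destruct f as [f Hf], g as [g Hg]; simpl; intros H.
assert (f = g) by (apply functional_extensionality; exact H); subst g.
f_equal; apply proof_irrelevance.
Qed.

Definition linf_plus (f g : linf) : linf.
Proof.
refine (Linf (fun i => plus (f i) (g i)) _).
destruct (linf_bounded f) as [M HM], (linf_bounded g) as [N HN].
exists (M + N); intros i; eapply Rle_trans; [apply abs_triangle | ].
apply Rplus_le_compat; auto.
Defined.

Definition linf_opp (f : linf) : linf.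
Proof.
refine (Linf (fun i => opp (f i)) _).
destruct (linf_bounded f) as [M HM]; exists M; intros i; rewrite abs_opp; auto.
Defined.

Definition linf_zero : linf.
Proof.
refine (Linf (fun _ => zero) _).
exists 0; intros i; rewrite abs_zero; apply Rle_refl.
Defined.

Definition linf_scal (a : k) (f : linf) : linf.
Proof.
refine (Linf (fun i => mult a (f i)) _).
destruct (linf_bounded f) as [M HM]; exists (abs a * M); intros i.
eapply Rle_trans; [apply abs_mult | apply Rmult_le_compat_l; [apply abs_ge_0 | auto]].
Defined.

(* For an empty index set the supremum is read as 0. *)
Definition linf_norm (f : linf) : R :=
  real (Lub_Rbar (fun r => exists i, r = abs (f i))).

Lemma linf_norm_ub (f : linf) (i : I) : abs (f i) <= linf_norm f.
Proof.
destruct (linf_bounded f) as [M HM].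
apply (Lub_Rbar_bounded (fun r => exists i, r = abs (f i)) M).
- exists (abs (f i)), i; reflexivity.
- intros r [j ->]; apply HM.
- exists i; reflexivity.
Qed.

Lemma linf_norm_empty (f : linf) : (forall i : I, False) -> linf_norm f = 0.
Proof.
intros HI; unfold linf_norm.
rewrite (is_lub_Rbar_unique _ m_infty); [reflexivity | ].
split; [intros r [i _]; destruct (HI i) | intros b _; exact Logic.I].
Qed.

Lemma linf_norm_le (f : linf) (M : R) :
  0 <= M -> (forall i, abs (f i) <= M) -> linf_norm f <= M.
Proof.
intros HM Hf; destruct (classic (exists i : I, True)) as [[i _] | HI].
- apply (Lub_Rbar_bounded (fun r => exists i, r = abs (f i)) M).
  + exists (abs (f i)), i; reflexivity.
  + intros r [j ->]; apply Hf.
- rewrite linf_norm_empty; [exact HM | intros i; apply HI; exists i; exact Logic.I].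
Qed.

Lemma linf_norm_ge0 (f : linf) : 0 <= linf_norm f.
Proof.
destruct (classic (exists i : I, True)) as [[i _] | HI].
- eapply Rle_trans; [apply (abs_ge_0 (f i)) | apply linf_norm_ub].
- rewrite linf_norm_empty; [lra | intros i; apply HI; exists i; exact Logic.I].
Qed.

Definition linf_AbelianMonoid_mixin : AbelianMonoid.mixin_of linf.
Proof.
apply (AbelianMonoid.Mixin linf linf_plus linf_zero).
- intros f g; apply linf_eq; intros i; apply plus_comm.
- intros f g h; apply linf_eq; intros i; apply plus_assoc.
- intros f; apply linf_eq; intros i; apply plus_zero_r.
Defined.

Canonical linf_AbelianMonoid :=
  AbelianMonoid.Pack linf linf_AbelianMonoid_mixin linf.

Definition linf_AbelianGroup_mixin : AbelianGroup.mixin_of linf_AbelianMonoid.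
Proof.
apply (AbelianGroup.Mixin linf_AbelianMonoid linf_opp).
intros f; apply linf_eq; intros i; exact (plus_opp_r (f i)).
Defined.

Canonical linf_AbelianGroup :=
  AbelianGroup.Pack linf
    (AbelianGroup.Class linf linf_AbelianMonoid_mixin linf_AbelianGroup_mixin) linf.

Definition linf_ModuleSpace_mixin : ModuleSpace.mixin_of k linf_AbelianGroup.
Proof.
apply (ModuleSpace.Mixin k linf_AbelianGroup linf_scal).
- intros a b f; apply linf_eq; intros i; apply mult_assoc.
- intros f; apply linf_eq; intros i; apply mult_one_l.
- intros a f g; apply linf_eq; intros i; exact (mult_distr_l a (f i) (g i)).
- intros a b f; apply linf_eq; intros i; exact (mult_distr_r a b (f i)).
Defined.

Canonical linf_ModuleSpace :=
  ModuleSpace.Pack k linf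
    (ModuleSpace.Class k linf (AbelianGroup.class linf_AbelianGroup)
       linf_ModuleSpace_mixin) linf.

Lemma linf_norm_triangle (f g : linf) :
  linf_norm (plus f g) <= linf_norm f + linf_norm g.
Proof.
apply linf_norm_le.
- apply Rplus_le_le_0_compat; apply linf_norm_ge0.
- intros i; eapply Rle_trans; [apply (abs_triangle (f i) (g i)) | ].
  apply Rplus_le_compat; apply linf_norm_ub.
Qed.

Lemma linf_norm_scal (a : k) (f : linf) :
  linf_norm (scal a f) <= abs a * linf_norm f.
Proof.
apply linf_norm_le.
- apply Rmult_le_pos; [apply abs_ge_0 | apply linf_norm_ge0].
- intros i; eapply Rle_trans; [apply (abs_mult a (f i)) | ].
  apply Rmult_le_compat_l; [apply abs_ge_0 | apply linf_norm_ub].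
Qed.

Lemma linf_norm_minus_sym (f g : linf) :
  linf_norm (minus f g) <= linf_norm (minus g f).
Proof.
apply linf_norm_le; [apply linf_norm_ge0 | intros i].
change (abs (minus (f i) (g i)) <= linf_norm (minus g f)).
rewrite <- abs_opp, opp_minus; exact (linf_norm_ub (minus g f) i).
Qed.

Definition linf_ball (f : linf) (e : R) (g : linf) : Prop :=
  linf_norm (minus g f) < e.

Definition linf_UniformSpace_mixin : UniformSpace.mixin_of linf.
Proof.
apply (UniformSpace.Mixin linf linf_zero linf_ball).
- intros f e; apply Rle_lt_trans with 0; [ | apply cond_pos].
  apply linf_norm_le; [lra | intros i].
  change (abs (minus (f i) (f i)) <= 0).
  rewrite minus_eq_zero; right; exact abs_zero.
- intros f g e H; eapply Rle_lt_trans; [apply linf_norm_minus_sym | exact H].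
- intros f g h e1 e2 H1 H2; unfold linf_ball.
  rewrite (minus_trans g h f), Rplus_comm.
  eapply Rle_lt_trans; [apply linf_norm_triangle | apply Rplus_lt_compat; assumption].
Defined.

Canonical linf_UniformSpace := UniformSpace.Pack linf linf_UniformSpace_mixin linf.

Canonical linf_NormedModuleAux :=
  NormedModuleAux.Pack k linf
    (NormedModuleAux.Class k linf (ModuleSpace.class k linf_ModuleSpace)
       (UniformSpace.class linf_UniformSpace)) linf.

Definition linf_NormedModule_mixin : NormedModule.mixin_of k linf_NormedModuleAux.
Proof.
apply (NormedModule.Mixin k linf_NormedModuleAux linf_norm 1).
- exact linf_norm_triangle.
- exact linf_norm_scal.
- intros f g e H; exact H.
- intros f g e H; rewrite Rmult_1_l; exact H.
- intros f H; apply linf_eq; intros i; apply abs_eq_zero.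
  apply Rle_antisym; [rewrite <- H; apply linf_norm_ub | apply abs_ge_0].
Defined.

Canonical linf_NormedModule :=
  NormedModule.Pack k linf
    (NormedModule.Class k linf (NormedModuleAux.class k linf_NormedModuleAux)
       linf_NormedModule_mixin) linf.

Lemma linf_cauchy_converge : cauchy_converge linf_UniformSpace.
Proof.
intros F HF HC.
assert (Hpt : forall i, exists l : AbsRing_UniformSpace k,
          forall eps : posreal, F (fun f => ball l eps (f i))).
{ intros i.
  apply (scalars_cauchy_converge k (fun P => F (fun f : linf => P (f i)))).
  - split.
    + intros P HP; destruct (filter_ex _ HP) as [f Hf]; exists (f i); exact Hf.
    + split; [apply filter_true | intros P Q; apply filter_and | ].
      intros P Q HPQ; apply filter_imp; intros f; apply HPQ.
  - intros eps; destruct (HC eps) as [f Hf]; exists (f i).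
    revert Hf; apply filter_imp; intros g Hg.
    eapply Rle_lt_trans; [exact (linf_norm_ub (minus g f) i) | exact Hg]. }
apply choice in Hpt; destruct Hpt as [l Hl].
(* If F charges the ball of radius e around g, then l is within e of g. *)
assert (Hclose : forall (g : linf) (e : posreal), F (ball g e) ->
          forall i, abs (minus (l i) (g i)) <= e).
{ intros g e Hg i; apply Rnot_lt_le; intros Hlt.
  assert (Hd : 0 < abs (minus (l i) (g i)) - e) by lra.
  destruct (filter_ex _ (filter_and _ _ Hg (Hl i (mkposreal _ Hd)))) as [h [H1 H2]].
  change (abs (minus (h i) (l i)) < abs (minus (l i) (g i)) - e) in H2.
  assert (H3 : abs (minus (h i) (g i)) < e)
    by (eapply Rle_lt_trans; [exact (linf_norm_ub (minus h g) i) | exact H1]).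
  assert (H4 : abs (minus (l i) (g i)) <=
               abs (minus (l i) (h i)) + abs (minus (h i) (g i)))
    by (rewrite (minus_trans (h i) (l i) (g i)); apply abs_triangle).
  rewrite <- (opp_minus (h i) (l i)), abs_opp in H4; lra. }
assert (Hbd : exists M : R, forall i, abs (l i) <= M).
{ destruct (HC (mkposreal 1 Rlt_0_1)) as [g Hg].
  exists (1 + linf_norm g); intros i.
  replace (l i) with (plus (minus (l i) (g i)) (g i))
    by (unfold minus; rewrite <- plus_assoc, plus_opp_l; apply plus_zero_r).
  eapply Rle_trans; [apply abs_triangle | ].
  apply Rplus_le_compat; [exact (Hclose g _ Hg i) | apply linf_norm_ub]. }
exists (Linf l Hbd); intros eps.
destruct (HC (pos_div_2 eps)) as [g Hg].
assert (Hlg : linf_norm (minus g (Linf l Hbd)) <= eps / 2).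
{ eapply Rle_trans; [apply linf_norm_minus_sym | ].
  apply linf_norm_le; [generalize (cond_pos eps); lra | exact (Hclose g _ Hg)]. }
apply (filter_imp (ball g (pos_div_2 eps))); [ | exact Hg].
intros h Hh; change (linf_norm (minus h g) < eps / 2) in Hh.
change (linf_norm (minus h (Linf l Hbd)) < eps).
rewrite (minus_trans g h (Linf l Hbd)).
eapply Rle_lt_trans; [apply linf_norm_triangle | lra].
Qed.

Canonical linf_CompleteNormedModule : CompleteNormedModule k :=
  CompleteNormedModule.Pack k linf
    (CompleteNormedModule.Class k linf (NormedModule.class k linf_NormedModule)
       (complete_mixin _ linf_cauchy_converge)) linf.

End LInfty.

Arguments Linf {k I}.
Arguments linf_fun {k I}.

Definition linf_dual {k : scalar_field} (E : CompleteNormedModule k) :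
    CompleteNormedModule k :=
  linf_CompleteNormedModule k (dual_ball E).

Lemma J_bounded {k : scalar_field} (E : CompleteNormedModule k) (y : E) :
  exists M : R, forall phi : dual_ball E, abs (proj1_sig phi y) <= M.
Proof.
exists (norm y); intros [phi [Hlin Hball]]; simpl.
eapply Rle_trans; [exact (op_norm_ub phi y Hlin) | ].
rewrite <- (Rmult_1_l (norm y)) at 2.
apply Rmult_le_compat_r; [apply norm_ge_0 | exact Hball].
Qed.

Definition J {k : scalar_field} (E : CompleteNormedModule k) (y : E) : linf_dual E :=
  Linf (fun phi : dual_ball E => proj1_sig phi y) (J_bounded E y).

Definition two_lip_class (k : scalar_field) : Type :=
  forall (X1 X2 : pointed_metric) (E : CompleteNormedModule k),
  (X1 -> X2 -> E) -> Prop.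

(* A norm on the class is encoded as a total function; only its values on members
   of the class are constrained or used. *)
Definition two_lip_norm (k : scalar_field) : Type :=
  forall (X1 X2 : pointed_metric) (E : CompleteNormedModule k),
  (X1 -> X2 -> E) -> R.

Record is_two_lip_ideal {k : scalar_field} (I : two_lip_class k) : Prop := {
  ideal_BLip0 : forall (X1 X2 : pointed_metric) (E : CompleteNormedModule k)
      (T : X1 -> X2 -> E), I X1 X2 E T -> BLip0 T;
  ideal_zero : forall (X1 X2 : pointed_metric) (E : CompleteNormedModule k),
    I X1 X2 E (fun _ _ => zero);
  ideal_plus : forall (X1 X2 : pointed_metric) (E : CompleteNormedModule k)
      (S T : X1 -> X2 -> E),
    I X1 X2 E S -> I X1 X2 E T ->
    I X1 X2 E (fun x1 x2 => plus (S x1 x2) (T x1 x2));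
  ideal_scal : forall (X1 X2 : pointed_metric) (E : CompleteNormedModule k)
      (a : k) (T : X1 -> X2 -> E),
    I X1 X2 E T -> I X1 X2 E (fun x1 x2 => scal a (T x1 x2));
  ideal_rank_one : forall (X1 X2 : pointed_metric) (E : CompleteNormedModule k)
      (f1 : X1 -> k) (f2 : X2 -> k) (e : E),
    Lip_dual X1 f1 -> Lip_dual X2 f2 ->
    I X1 X2 E (fun x1 x2 => scal (mult (f1 x1) (f2 x2)) e);
  ideal_comp : forall (X1 X2 Z W : pointed_metric) (E F : CompleteNormedModule k)
      (f1 : Z -> X1) (f2 : W -> X2) (T : X1 -> X2 -> E) (u : E -> F),
    Lip0 f1 -> Lip0 f2 -> I X1 X2 E T -> is_linear u ->
    I Z W F (fun z w => u (T (f1 z) (f2 w))) }.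

Record is_normed_two_lip_ideal {k : scalar_field}
    (I : two_lip_class k) (nI : two_lip_norm k) : Prop := {
  normed_ideal : is_two_lip_ideal I;
  normed_ge0 : forall (X1 X2 : pointed_metric) (E : CompleteNormedModule k)
      (T : X1 -> X2 -> E),
    I X1 X2 E T -> 0 <= nI X1 X2 E T;
  normed_eq0 : forall (X1 X2 : pointed_metric) (E : CompleteNormedModule k)
      (T : X1 -> X2 -> E),
    I X1 X2 E T -> nI X1 X2 E T = 0 -> forall x1 x2, T x1 x2 = zero;
  normed_scal : forall (X1 X2 : pointed_metric) (E : CompleteNormedModule k)
      (a : k) (T : X1 -> X2 -> E), I X1 X2 E T ->
    nI X1 X2 E (fun x1 x2 => scal a (T x1 x2)) = abs a * nI X1 X2 E T;
  normed_triangle : forall (X1 X2 : pointed_metric) (E : CompleteNormedModule k)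
      (S T : X1 -> X2 -> E),
    I X1 X2 E S -> I X1 X2 E T ->
    nI X1 X2 E (fun x1 x2 => plus (S x1 x2) (T x1 x2))
      <= nI X1 X2 E S + nI X1 X2 E T;
  normed_BLip : forall (X1 X2 : pointed_metric) (E : CompleteNormedModule k)
      (T : X1 -> X2 -> E),
    I X1 X2 E T -> BLip T <= nI X1 X2 E T;
  normed_Id : nI (scalar_pointed k) (scalar_pointed k) (scalar_space k)
      (fun a b : k => mult a b) = 1;
  normed_comp : forall (X1 X2 Z W : pointed_metric) (E F : CompleteNormedModule k)
      (f1 : Z -> X1) (f2 : W -> X2) (T : X1 -> X2 -> E) (u : E -> F),
    Lip0 f1 -> Lip0 f2 -> I X1 X2 E T -> is_linear u ->
    nI Z W F (fun z w => u (T (f1 z) (f2 w)))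
      <= op_norm u * nI X1 X2 E T * Lip f1 * Lip f2 }.

Definition two_lip_components_complete {k : scalar_field}
    (I : two_lip_class k) (nI : two_lip_norm k) : Prop :=
  forall (X1 X2 : pointed_metric) (E : CompleteNormedModule k)
    (T : nat -> X1 -> X2 -> E),
  (forall n, I X1 X2 E (T n)) ->
  (forall eps : R, 0 < eps -> exists N : nat, forall n m : nat,
     (N <= n)%nat -> (N <= m)%nat ->
     nI X1 X2 E (fun x1 x2 => minus (T n x1 x2) (T m x1 x2)) < eps) ->
  exists S : X1 -> X2 -> E, I X1 X2 E S /\
    forall eps : R, 0 < eps -> exists N : nat, forall n : nat, (N <= n)%nat ->
      nI X1 X2 E (fun x1 x2 => minus (T n x1 x2) (S x1 x2)) < eps.

Definition is_banach_two_lip_ideal {k : scalar_field}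
    (I : two_lip_class k) (nI : two_lip_norm k) : Prop :=
  is_normed_two_lip_ideal I nI /\ two_lip_components_complete I nI.

Definition inj_hull {k : scalar_field} (I : two_lip_class k) : two_lip_class k :=
  fun X1 X2 E T =>
    BLip0 T /\ I X1 X2 (linf_dual E) (fun x1 x2 => J E (T x1 x2)).

Definition inj_hull_norm {k : scalar_field} (nI : two_lip_norm k) : two_lip_norm k :=
  fun X1 X2 E T => nI X1 X2 (linf_dual E) (fun x1 x2 => J E (T x1 x2)).

(* Main.v *)
From Stdlib Require Import Lra Classical ClassicalEpsilon FunctionalExtensionality.
From Corelib Require Import ssreflect.
From mathcomp Require boolp classical_sets.
Require Import Defs.

(** Everything rests on three facts about the embedding [J E] of [E] into the
bounded functions on the dual ball.

It is a linear isometry ([norm_J]).  The nontrivial inequality is the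
Hahn-Banach theorem: every vector has a functional in the dual ball that attains
its norm ([dual_ball_norming]).  Hence [T] and [J o T] satisfy the same
two-Lipschitz inequalities and have the same [BLip], which gives the bound
[BLip T <= nI (J o T)] and the definiteness of the norm of the hull.

Every bounded [u : E -> F] lifts along the embeddings to a bounded [v] with
[v o J E = J F o u] and [op_norm v <= op_norm u] ([linear_lift]).  Indeed
[phi o u] is, for each [phi] in the ball of the dual of [F], a multiple by at most
[op_norm u] of an element of the ball of the dual of [E], so [v] can be defined
coordinate by coordinate.  The ideal property of the hull is then that of [I],
applied to [v].

Its range is closed, because [E] is complete ([J_range_closed]).  If [J o T n]
converges in the norm of [I], it converges pointwise, since [BLip] is below that
norm; so its limit takes values in the range of [J E], and factors as [J o S].
This gives completeness of the hull.

Sums and scalar multiples pass through the linear [J E], and rank-one maps are in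
the hull because an ideal is contained in its hull.  The product of scalars keeps
norm one: [J] has norm at most one, and so has the evaluation at the identity
functional, which recovers the product from its image under [J].

The Hahn-Banach theorem is obtained without extending functionals step by step:
Zorn's lemma provides a minimal element among the sublinear functionals below a
given one, and minimal sublinear functionals are linear
([minimal_sublinear_linear]). *)

Lemma Glb_Rbar_bounded (P : R -> Prop) (m : R) :
  (exists r, P r) -> (forall r, P r -> m <= r) ->
  (forall r, P r -> real (Glb_Rbar P) <= r) /\
  (forall b, (forall r, P r -> b <= r) -> b <= real (Glb_Rbar P)).
Proof.
intros [r0 H0] Hm.
destruct (Glb_Rbar_correct P) as [Hlb Hglb].
pose proof (Hlb _ H0) as Hr0.
assert (Hgm : Rbar_le m (Glb_Rbar P)) by (apply Hglb; intros r Hr; exact (Hm r Hr)).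
destruct (Glb_Rbar P) as [l | |]; simpl in *; try contradiction.
split; [intros r Hr; exact (Hlb _ Hr) | ].
intros b Hb; exact (Hglb (Finite b) Hb).
Qed.

Lemma plus_interchange {G : AbelianMonoid} (a b c d : G) :
  plus (plus a b) (plus c d) = plus (plus a c) (plus b d).
Proof.
rewrite -!plus_assoc; f_equal; rewrite !plus_assoc; f_equal; apply plus_comm.
Qed.

(** * Hahn-Banach theorem through minimal sublinear functionals *)

Section Sublinear.

Context {V : ModuleSpace R_Ring}.
Implicit Types (p q : V -> R) (x y : V).

(** Homogeneity is only asked as an inequality, and for [0 <= t]; the reverse
inequality follows for [0 < t] by applying it to the inverse of [t]. *)
Record sublinear p : Prop := {
  sublinear_plus : forall x y, p (plus x y) <= p x + p y;
  sublinear_scal : forall (t : R) x, 0 <= t -> p (scal t x) <= t * p x }.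

Lemma sublinear_zero p : sublinear p -> p zero = 0.
Proof.
intros Hp; apply Rle_antisym.
- pose proof (sublinear_scal p Hp 0 zero (Rle_refl 0)) as H.
  rewrite (scal_zero_l (K := R_Ring)) in H; lra.
- pose proof (sublinear_plus p Hp zero zero) as H; rewrite plus_zero_l in H; lra.
Qed.

Lemma sublinear_lower p q : sublinear q -> (forall x, q x <= p x) ->
  forall x, - p (opp x) <= q x.
Proof.
intros Hq Hqp x.
pose proof (sublinear_plus q Hq x (opp x)) as H.
rewrite (plus_opp_r x) (sublinear_zero q Hq) in H; specialize (Hqp (opp x)); lra.
Qed.

(** The largest sublinear functional below [p] whose value at [opp y] is at most
[- p y].  Replacing [p] by it forces linearity along [y] without moving the value
at [y]. *)
Definition tilt p y x : R :=
  real (Glb_Rbar (fun r => exists t, 0 <= t /\ r = p (plus x (scal t y)) - t * p y)).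

(** The infimum is finite: [t * p y <= p (scal t y)], so subadditivity bounds the
competitors from below by [- p (opp x)]. *)
Lemma tilt_glb p y : sublinear p -> forall x,
  (forall t, 0 <= t -> tilt p y x <= p (plus x (scal t y)) - t * p y) /\
  (forall b, (forall t, 0 <= t -> b <= p (plus x (scal t y)) - t * p y) ->
     b <= tilt p y x).
Proof.
intros Hp x; unfold tilt.
destruct (Glb_Rbar_bounded
  (fun r => exists t, 0 <= t /\ r = p (plus x (scal t y)) - t * p y)
  (- p (opp x))) as [H1 H2].
- eexists; exists 0; split; [apply Rle_refl | reflexivity].
- intros r [t [Ht ->]].
  assert (Hty : t * p y <= p (scal t y)).
  { destruct Ht as [Ht | <-].
    - assert (Hi : 0 < / t) by (apply Rinv_0_lt_compat; exact Ht).
      pose proof (sublinear_scal p Hp (/ t) (scal t y) (Rlt_le _ _ Hi)) as H.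
      rewrite scal_assoc in H; change (mult (/ t) t) with (/ t * t) in H.
      rewrite (Rinv_l t (Rgt_not_eq _ _ Ht)) (scal_one (K := R_Ring) y) in H.
      apply (Rmult_le_compat_l t) in H; [ | lra].
      rewrite -Rmult_assoc (Rinv_r t (Rgt_not_eq _ _ Ht)) Rmult_1_l in H; exact H.
    - rewrite (scal_zero_l (K := R_Ring) y) (sublinear_zero p Hp); lra. }
  pose proof (sublinear_plus p Hp (opp x) (plus x (scal t y))) as H.
  rewrite (plus_assoc (opp x)) (plus_opp_l x) (plus_zero_l (scal t y)) in H; lra.
- split.
  + intros t Ht; apply H1; exists t; auto.
  + intros b Hb; apply H2; intros r [t [Ht ->]]; auto.
Qed.

Lemma tilt_le p y x : sublinear p -> tilt p y x <= p x.
Proof.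
intros Hp; destruct (tilt_glb p y Hp x) as [H _].
specialize (H 0 (Rle_refl 0)).
rewrite (scal_zero_l (K := R_Ring) y) plus_zero_r in H; lra.
Qed.

Lemma tilt_shift p y x : sublinear p -> tilt p y x <= p (plus x y) - p y.
Proof.
intros Hp; destruct (tilt_glb p y Hp x) as [H _].
specialize (H 1 Rle_0_1); rewrite (scal_one (K := R_Ring) y) in H; lra.
Qed.

(** Competitors for [x] and [x'] with parameters [t] and [s] add up to one for
[plus x x'] with parameter [t + s], and competitors for [scal a x] are [a] times
those for [x], after the change of parameter [a * t]. *)
Lemma tilt_sublinear p y : sublinear p -> sublinear (tilt p y).
Proof.
intros Hp; split.
- intros x x'.
  enough (H : tilt p y (plus x x') - tilt p y x' <= tilt p y x) by lra.
  apply (tilt_glb p y Hp x); intros t Ht.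
  enough (H : tilt p y (plus x x') - (p (plus x (scal t y)) - t * p y)
              <= tilt p y x') by lra.
  apply (tilt_glb p y Hp x'); intros s Hs.
  assert (E : plus (plus x x') (scal (t + s) y)
              = plus (plus x (scal t y)) (plus x' (scal s y))).
  { rewrite (scal_distr_r (K := R_Ring) t s y); apply plus_interchange. }
  pose proof (proj1 (tilt_glb p y Hp (plus x x')) (t + s)
    (Rplus_le_le_0_compat _ _ Ht Hs)) as H.
  rewrite E in H.
  pose proof (sublinear_plus p Hp (plus x (scal t y)) (plus x' (scal s y))).
  lra.
- intros a x [Ha | <-].
  + assert (Hi : 0 < / a) by (apply Rinv_0_lt_compat; exact Ha).
    enough (H : / a * tilt p y (scal a x) <= tilt p y x).
    { apply (Rmult_le_compat_l a) in H; [ | lra].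
      rewrite -Rmult_assoc (Rinv_r a (Rgt_not_eq _ _ Ha)) Rmult_1_l in H; exact H. }
    apply (tilt_glb p y Hp x); intros t Ht.
    assert (Hat : 0 <= a * t) by (apply Rmult_le_pos; lra).
    pose proof (proj1 (tilt_glb p y Hp (scal a x)) (a * t) Hat) as H.
    assert (E : plus (scal a x) (scal (a * t) y) = scal a (plus x (scal t y))).
    { rewrite (scal_distr_l a x) (scal_assoc (K := R_Ring) a t y); reflexivity. }
    rewrite E in H.
    pose proof (sublinear_scal p Hp a (plus x (scal t y)) (Rlt_le _ _ Ha)) as H'.
    apply Rle_trans with (/ a * (a * (p (plus x (scal t y)) - t * p y))).
    * apply Rmult_le_compat_l; lra.
    * right; field; lra.
  + rewrite (scal_zero_l (K := R_Ring) x).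
    pose proof (tilt_le p y zero Hp) as H; rewrite (sublinear_zero p Hp) in H; lra.
Qed.

(** Subadditivity is where a chain is needed: the infima at [x] and at [y] are
approached by different members, and the smaller of these does for both. *)
Lemma chain_infimum_sublinear p (A : (V -> R) -> Prop) :
  (exists q, A q) -> (forall q, A q -> sublinear q /\ forall x, q x <= p x) ->
  (forall q r, A q -> A r -> (forall x, q x <= r x) \/ (forall x, r x <= q x)) ->
  exists m, sublinear m /\ forall q, A q -> forall x, m x <= q x.
Proof.
intros [q0 Hq0] HA Hchain.
set (m := fun x => real (Glb_Rbar (fun r => exists q, A q /\ r = q x))).
assert (Hm : forall x, (forall q, A q -> m x <= q x) /\
               (forall b, (forall q, A q -> b <= q x) -> b <= m x)).
{ intros x.
  destruct (Glb_Rbar_bounded (fun r => exists q, A q /\ r = q x) (- p (opp x)))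
    as [H1 H2].
  - exists (q0 x), q0; auto.
  - intros r [q [Hq ->]]; apply sublinear_lower; apply (HA q Hq).
  - split.
    + intros q Hq; apply H1; exists q; auto.
    + intros b Hb; apply H2; intros r [q [Hq ->]]; auto. }
exists m; split; [split | intros q Hq x; exact (proj1 (Hm x) q Hq)].
- intros x y.
  enough (H : m (plus x y) - m y <= m x) by lra.
  apply (Hm x); intros q Hq.
  enough (H : m (plus x y) - q x <= m y) by lra.
  apply (Hm y); intros r Hr.
  (* q is evaluated at x and r at y; the smaller of the two serves at both *)
  destruct (Hchain q r Hq Hr) as [H | H].
  + pose proof (proj1 (Hm (plus x y)) q Hq).
    pose proof (sublinear_plus q (proj1 (HA q Hq)) x y); specialize (H y); lra.
  + pose proof (proj1 (Hm (plus x y)) r Hr).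
    pose proof (sublinear_plus r (proj1 (HA r Hr)) x y); specialize (H x); lra.
- intros a x [Ha | <-].
  + assert (Hi : 0 < / a) by (apply Rinv_0_lt_compat; exact Ha).
    enough (H : / a * m (scal a x) <= m x).
    { apply (Rmult_le_compat_l a) in H; [ | lra].
      rewrite -Rmult_assoc (Rinv_r a (Rgt_not_eq _ _ Ha)) Rmult_1_l in H; exact H. }
    apply (Hm x); intros q Hq.
    apply Rle_trans with (/ a * (a * q x)); [ | right; field; lra].
    apply Rmult_le_compat_l; [lra | ].
    eapply Rle_trans; [exact (proj1 (Hm (scal a x)) q Hq) | ].
    apply (sublinear_scal q (proj1 (HA q Hq))); lra.
  + pose proof (proj1 (Hm (scal 0 x)) q0 Hq0).
    pose proof (sublinear_scal q0 (proj1 (HA q0 Hq0)) 0 x (Rle_refl 0)); lra.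
Qed.

Lemma minimal_sublinear p : sublinear p ->
  exists q, sublinear q /\ (forall x, q x <= p x) /\
    forall r, sublinear r -> (forall x, r x <= q x) -> forall x, q x <= r x.
Proof.
intros Hp.
set (S := {q | sublinear q /\ forall x, q x <= p x}).
set (below := fun u v : S => forall x, proj1_sig v x <= proj1_sig u x).
assert (HR : forall u v : S, is_true (boolp.asbool (below u v)) <-> below u v).
{ intros u v; unfold is_true; destruct (boolp.asboolP (below u v)); split; easy. }
pose (top := exist _ p (conj Hp (fun x => Rle_refl (p x))) : S).
destruct (@classical_sets.ZL_preorder S top
  (fun u v => boolp.asbool (below u v))) as [[q [Hq Hqp]] Hmin].
- intros u; apply HR; intros x; apply Rle_refl.
- intros u v w Huv Hvw; apply HR; intros x.
  eapply Rle_trans; [apply (proj1 (HR _ _) Hvw) | apply (proj1 (HR _ _) Huv)].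
- intros A HA.
  destruct (classic (exists u, A u)) as [[u0 Hu0] | HA0].
  2: { exists top; intros u Hu; destruct HA0; exists u; exact Hu. }
  destruct (chain_infimum_sublinear p (fun f => exists u, A u /\ f = proj1_sig u))
    as [m [Hm Hmq]].
  + exists (proj1_sig u0), u0; auto.
  + intros f [u [_ ->]]; exact (proj2_sig u).
  + intros f g [u [Hu ->]] [v [Hv ->]].
    destruct (HA u v Hu Hv) as [H | H]; apply HR in H; auto.
  + assert (Hmp : forall x, m x <= p x).
    { intros x; eapply Rle_trans; [apply (Hmq (proj1_sig u0)); exists u0; auto | ].
      apply (proj2_sig u0). }
    exists (exist _ m (conj Hm Hmp)); intros u Hu; apply HR; intros x.
    apply Hmq; exists u; auto.
- exists q; split; [exact Hq | split; [exact Hqp | ]].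
  intros r Hr Hrq.
  assert (Hrp : forall x, r x <= p x)
    by (intros x; eapply Rle_trans; [apply Hrq | apply Hqp]).
  apply (proj1 (HR (exist _ r (conj Hr Hrp)) (exist _ q (conj Hq Hqp)))), Hmin, HR.
  exact Hrq.
Qed.

(** For a minimal [q] every [tilt q y] equals [q]; its competitor for [t = 1] then
reads [q x + q y <= q (plus x y)]. *)
Lemma minimal_sublinear_linear q : sublinear q ->
  (forall r, sublinear r -> (forall x, r x <= q x) -> forall x, q x <= r x) ->
  (forall x y, q (plus x y) = q x + q y) /\
  (forall (t : R) x, q (scal t x) = t * q x).
Proof.
intros Hq Hmin.
assert (Hplus : forall x y, q (plus x y) = q x + q y).
{ intros x y; apply Rle_antisym; [apply (sublinear_plus q Hq) | ].
  pose proof (Hmin _ (tilt_sublinear q y Hq) (fun z => tilt_le q y z Hq) x).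
  pose proof (tilt_shift q y x Hq); lra. }
assert (Hopp : forall x, q (opp x) = - q x).
{ intros x; pose proof (Hplus x (opp x)) as H.
  rewrite (plus_opp_r x) (sublinear_zero q Hq) in H; lra. }
assert (Hpos : forall (t : R) x, 0 <= t -> q (scal t x) = t * q x).
{ intros t x Ht; apply Rle_antisym; [apply (sublinear_scal q Hq); exact Ht | ].
  pose proof (sublinear_scal q Hq t (opp x) Ht) as H.
  rewrite scal_opp_r !Hopp in H; lra. }
split; [exact Hplus | ].
intros t x; destruct (Rle_lt_dec 0 t) as [Ht | Ht]; [apply Hpos; exact Ht | ].
assert (H : q (scal (- t) x) = - t * q x) by (apply Hpos; lra).
change (- t) with (opp t : R_Ring) in H at 1.
rewrite scal_opp_l Hopp in H; lra.
Qed.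

(** A minimal functional is taken below [tilt p x0] rather than below [p]: the
bound [- p x0] at [opp x0] becomes, by linearity, [p x0 <= g x0]. *)
Theorem hahn_banach_support p x0 : sublinear p ->
  exists g : V -> R,
    (forall x y, g (plus x y) = g x + g y) /\
    (forall (t : R) x, g (scal t x) = t * g x) /\
    (forall x, g x <= p x) /\ g x0 = p x0.
Proof.
intros Hp.
destruct (minimal_sublinear _ (tilt_sublinear p x0 Hp)) as [g [Hg [Hgp Hmin]]].
destruct (minimal_sublinear_linear g Hg Hmin) as [Hplus Hscal].
assert (Hle : forall x, g x <= p x)
  by (intros x; eapply Rle_trans; [apply Hgp | apply tilt_le; exact Hp]).
exists g; split; [exact Hplus | split; [exact Hscal | split; [exact Hle | ]]].
apply Rle_antisym; [apply Hle | ].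
pose proof (Hplus x0 (opp x0)) as H0; rewrite (plus_opp_r x0) (sublinear_zero g Hg) in H0.
pose proof (Hgp (opp x0)) as H1; pose proof (tilt_shift p x0 (opp x0) Hp) as H2.
rewrite (plus_opp_l x0) (sublinear_zero p Hp) in H2; lra.
Qed.

End Sublinear.

(** * Norm-attaining functionals on the dual ball *)

Lemma scalars_mult_comm (k : scalar_field) (a b : k) : mult a b = mult b a.
Proof. destruct k; [apply Rmult_comm | apply Cmult_comm]. Qed.

Lemma op_norm_le {k : scalar_field} {E F : NormedModule k} (u : E -> F) (M : R) :
  0 <= M -> (forall x, norm (u x) <= M * norm x) -> op_norm u <= M.
Proof.
intros HM Hu; unfold op_norm.
apply (Lub_Rbar_bounded _ M).
- exists (norm (u zero)), zero; split; [rewrite norm_zero; lra | reflexivity].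
- intros r [x [Hx ->]]; eapply Rle_trans; [apply Hu | ].
  rewrite -{2}(Rmult_1_r M); apply Rmult_le_compat_l; assumption.
Qed.

Lemma op_norm_ge0 {k : scalar_field} {E F : NormedModule k} (u : E -> F) :
  is_linear u -> 0 <= op_norm u.
Proof.
intros Hu; destruct (linear_norm _ Hu) as [M [HM Hbd]].
assert (H0 : norm (u zero) <= op_norm u).
{ apply (Lub_Rbar_bounded (fun r => exists x : E, norm x <= 1 /\ r = norm (u x)) M).
  - exists (norm (u zero)), zero; split; [rewrite norm_zero; lra | reflexivity].
  - intros r [x [Hx ->]]; eapply Rle_trans; [apply Hbd | ].
    rewrite -{2}(Rmult_1_r M); apply Rmult_le_compat_l; lra.
  - exists zero; split; [rewrite norm_zero; lra | reflexivity]. }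
exact (Rle_trans _ _ _ (norm_ge_0 (u zero)) H0).
Qed.

(** Restriction of scalars from the complex to the real numbers, with the same
carrier, so that the real theorem applies to complex spaces. *)
Definition realify_mixin (V : ModuleSpace C_Ring) :
  ModuleSpace.mixin_of R_Ring (ModuleSpace.AbelianGroup C_Ring V).
Proof.
apply (ModuleSpace.Mixin R_Ring (ModuleSpace.AbelianGroup C_Ring V)
         (fun t x => scal (RtoC t : C_Ring) (x : V))).
- intros s t x.
  change (mult s t : R_Ring) with (s * t); rewrite RtoC_mult; exact (scal_assoc _ _ _).
- intros x; exact (scal_one (K := C_Ring) (V := V) x).
- intros t x y; exact (scal_distr_l (K := C_Ring) (V := V) (RtoC t) x y).
- intros s t x.
  change (plus s t : R_Ring) with (s + t); rewrite RtoC_plus.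
  exact (scal_distr_r (K := C_Ring) (V := V) (RtoC s) (RtoC t) x).
Defined.

Definition realify (V : ModuleSpace C_Ring) : ModuleSpace R_Ring :=
  ModuleSpace.Pack R_Ring V
    (ModuleSpace.Class R_Ring V (AbelianGroup.class (ModuleSpace.AbelianGroup C_Ring V))
       (realify_mixin V)) V.

Lemma norming_functional_real (E : NormedModule R_AbsRing) (x0 : E) :
  exists phi : E -> R,
    (forall x y, phi (plus x y) = phi x + phi y) /\
    (forall (t : R) x, phi (scal t x) = t * phi x) /\
    (forall x, Rabs (phi x) <= norm x) /\ norm x0 <= Rabs (phi x0).
Proof.
assert (Hn : sublinear (fun x : E => norm x)).
{ split; [intros x y; exact (norm_triangle (x : E) y) | ].
  intros t x Ht; eapply Rle_trans; [exact (norm_scal (t : R_AbsRing) (x : E)) | ].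
  change (abs (t : R_AbsRing)) with (Rabs t); rewrite Rabs_pos_eq;
    [apply Rle_refl | exact Ht]. }
destruct (hahn_banach_support _ x0 Hn) as [g [Hplus [Hscal [Hle Heq]]]].
exists g; split; [exact Hplus | split; [exact Hscal | split]].
- intros x; apply Rabs_le; split; [ | apply Hle].
  pose proof (Hle (opp x)) as H; rewrite norm_opp in H.
  assert (E1 : g (opp x) = - g x).
  { rewrite -(scal_opp_one x) Hscal; change (opp one : R_Ring) with (- 1); lra. }
  lra.
- rewrite -Heq; apply Rle_abs.
Qed.

(** The real functional [g] is the real part of the complex linear
[phi x = g x - i g (i x)].  The bound passes from [g] to [phi] by evaluating at the
multiple of [x] by the conjugate of [phi x], where [phi] takes the real value
[Cmod (phi x) ^ 2]. *)
Lemma norming_functional_complex (E : NormedModule C_AbsRing) (x0 : E) :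
  exists phi : E -> Complex.C,
    (forall x y, phi (plus x y) = Cplus (phi x) (phi y)) /\
    (forall (a : Complex.C) x, phi (scal a x) = Cmult a (phi x)) /\
    (forall x, Cmod (phi x) <= norm x) /\ norm x0 <= Cmod (phi x0).
Proof.
assert (Hn : sublinear (V := realify E) (fun x : E => norm x)).
{ split; [intros x y; exact (norm_triangle (x : E) y) | ].
  intros t x Ht; eapply Rle_trans; [exact (norm_scal (RtoC t : C_AbsRing) (x : E)) | ].
  change (abs (RtoC t : C_AbsRing)) with (Cmod (RtoC t)).
  rewrite Cmod_R Rabs_pos_eq; [apply Rle_refl | exact Ht]. }
destruct (hahn_banach_support (V := realify E) _ x0 Hn) as [g [Hplus [Hscal [Hle Heq]]]].
change (forall x y : E, g (plus x y) = g x + g y) in Hplus.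
change (forall (t : R) (x : E), g (scal (RtoC t : C_AbsRing) x) = t * g x) in Hscal.
change (forall x : E, g x <= norm x) in Hle.
pose (phi := fun x : E => (g x, - g (scal (Ci : C_AbsRing) x)) : Complex.C).
assert (Hg : forall (a : Complex.C) (x : E), g (scal (a : C_AbsRing) x)
               = fst a * g x + snd a * g (scal (Ci : C_AbsRing) x)).
{ intros [a b] x; simpl fst; simpl snd.
  replace ((a, b) : C_AbsRing)
    with (plus (RtoC a : C_AbsRing) (mult (RtoC b : C_AbsRing) (Ci : C_AbsRing))).
  - rewrite scal_distr_r Hplus Hscal -scal_assoc Hscal; reflexivity.
  - apply injective_projections; cbn; ring. }
assert (Hphi : forall (a : Complex.C) (x : E),
  phi (scal (a : C_AbsRing) x) = Cmult a (phi x)).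
{ intros a x; unfold phi; rewrite scal_assoc (Hg a x) (Hg (Cmult Ci a) x).
  apply injective_projections; cbn; ring. }
exists phi; split; [ | split; [exact Hphi | split]].
- intros x y; unfold phi; rewrite scal_distr_l !Hplus.
  apply injective_projections; cbn; ring.
- intros x; destruct (Rle_lt_or_eq_dec _ _ (Cmod_ge_0 (phi x))) as [H | <-];
    [ | apply norm_ge_0].
  apply (Rmult_le_reg_l (Cmod (phi x))); [exact H | ].
  assert (E1 : Cmod (phi x) * Cmod (phi x) = g (scal (Cconj (phi x) : C_AbsRing) x)).
  { change (g (scal (Cconj (phi x) : C_AbsRing) x))
      with (fst (phi (scal (Cconj (phi x) : C_AbsRing) x))).
    rewrite Hphi; unfold Cmod; rewrite sqrt_sqrt; [cbn; ring | ].
    apply Rplus_le_le_0_compat; apply pow2_ge_0. }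
  rewrite E1; eapply Rle_trans; [apply Hle | ].
  eapply Rle_trans; [apply norm_scal | ].
  change (Cmod (Cconj (phi x)) * norm x <= Cmod (phi x) * norm x).
  rewrite Cmod_conj; apply Rle_refl.
- eapply Rle_trans; [ | apply (Rmax_Cmod (phi x0))].
  eapply Rle_trans; [ | apply Rmax_l].
  rewrite -Heq; apply Rle_abs.
Qed.

Theorem dual_ball_norming {k : scalar_field} (E : NormedModule k) (x0 : E) :
  exists phi : dual_ball E, norm x0 <= abs (proj1_sig phi x0).
Proof.
assert (H : exists phi : E -> AbsRing_NormedModule k,
    (forall x y, phi (plus x y) = plus (phi x) (phi y)) /\
    (forall (a : k) x, phi (scal a x) = scal a (phi x)) /\
    (forall x, norm (phi x) <= norm x) /\ norm x0 <= abs (phi x0))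
  by (destruct k; [exact (norming_functional_real E x0)
                  | exact (norming_functional_complex E x0)]).
destruct H as [phi [Hplus [Hscal [Hle Hx0]]]].
assert (Hle1 : forall x, norm (phi x) <= 1 * norm x)
  by (intros x; rewrite Rmult_1_l; apply Hle).
assert (Hphi : is_linear phi /\ op_norm phi <= 1).
{ split; [split; [exact Hplus | exact Hscal | exists 1; split; [lra | exact Hle1]] | ].
  apply op_norm_le; [lra | exact Hle1]. }
exists (exist _ phi Hphi); exact Hx0.
Qed.

(** * The embedding into bounded functions on the dual ball *)

Section Embedding.

Context {k : scalar_field}.

Lemma J_plus {E : CompleteNormedModule k} (x y : E) :
  J E (plus x y) = plus (J E x) (J E y).
Proof.
apply linf_eq; intros [phi [Hphi ?]]; exact (linear_plus _ Hphi x y).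
Qed.

Lemma J_scal {E : CompleteNormedModule k} (a : k) (x : E) :
  J E (scal a x) = scal a (J E x).
Proof.
apply linf_eq; intros [phi [Hphi ?]]; exact (linear_scal _ Hphi a x).
Qed.

Lemma J_minus {E : CompleteNormedModule k} (x y : E) :
  J E (minus x y) = minus (J E x) (J E y).
Proof.
unfold minus; rewrite J_plus; f_equal.
apply linf_eq; intros [phi [Hphi ?]]; exact (linear_opp phi y Hphi).
Qed.

Lemma norm_J {E : CompleteNormedModule k} (y : E) : norm (J E y) = norm y.
Proof.
change (linf_norm k (dual_ball E) (J E y) = norm y); apply Rle_antisym.
- apply linf_norm_le; [apply norm_ge_0 | intros [phi [Hphi H1]]; simpl].
  eapply Rle_trans; [exact (op_norm_ub phi y Hphi) | ].
  rewrite -{2}(Rmult_1_l (norm y)).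
  apply Rmult_le_compat_r; [apply norm_ge_0 | exact H1].
- destruct (dual_ball_norming E y) as [phi Hphi].
  eapply Rle_trans; [exact Hphi | exact (linf_norm_ub k _ (J E y) phi)].
Qed.

Lemma J_linear (E : CompleteNormedModule k) : is_linear (J E).
Proof.
split; [exact J_plus | exact J_scal | ].
exists 1; split; [lra | intros x; rewrite norm_J Rmult_1_l; apply Rle_refl].
Qed.

Lemma op_norm_J (E : CompleteNormedModule k) : op_norm (J E) <= 1.
Proof.
apply op_norm_le; [lra | intros x; rewrite norm_J Rmult_1_l; apply Rle_refl].
Qed.

Lemma norm_minus_sym {E : CompleteNormedModule k} (x y : E) :
  norm (minus x y) = norm (minus y x).
Proof. rewrite -norm_opp; f_equal; exact (opp_minus x y). Qed.

Lemma norm_minus_triangle {E : CompleteNormedModule k} (y x z : E) :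
  norm (minus x z) <= norm (minus x y) + norm (minus y z).
Proof. rewrite (minus_trans y x z); exact (norm_triangle _ _). Qed.

(** As [J E] is an isometry, the sequence [y] is Cauchy in the complete space [E],
and the image of its limit is [z]. *)
Lemma J_range_closed {E : CompleteNormedModule k} (y : nat -> E) (z : linf_dual E) :
  (forall eps, 0 < eps -> exists N, forall n, (N <= n)%nat ->
     norm (minus (J E (y n)) z) < eps) ->
  exists y0, J E y0 = z.
Proof.
intros Hz.
destruct (proj1 (filterlim_locally_cauchy (F := eventually) y)) as [y0 Hy0].
{ intros eps; destruct (Hz (eps / 2)) as [N HN]; [apply is_pos_div_2 | ].
  exists (fun n => (N <= n)%nat); split; [exists N; auto | intros n m Hn Hm].
  assert (H : norm (minus (y m) (y n)) < eps).
  { rewrite -norm_J J_minus.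
    pose proof (norm_minus_triangle z (J E (y m)) (J E (y n))) as H.
    rewrite (norm_minus_sym z) in H.
    pose proof (HN n Hn); pose proof (HN m Hm); lra. }
  exact (norm_compat1 _ _ _ H). }
exists y0.
assert (H0 : norm (minus (J E y0) z) <= 0).
{ apply le_epsilon; intros eps He; rewrite Rplus_0_l.
  pose proof (@norm_factor_gt_0 _ E) as Hf.
  assert (He1 : 0 < eps / 2 / @norm_factor _ E) by (apply Rdiv_lt_0_compat; lra).
  destruct (Hz (eps / 2)) as [N HN]; [lra | ].
  destruct (proj1 (filterlim_locally y y0) Hy0 (mkposreal _ He1)) as [M HM].
  specialize (HN (max N M) (Nat.le_max_l _ _)).
  specialize (HM (max N M) (Nat.le_max_r _ _)).
  set (x := y (max N M)) in *.
  assert (H1 : norm (minus x y0) < norm_factor * (eps / 2 / @norm_factor _ E))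
    by exact (norm_compat2 _ _ _ HM).
  replace (norm_factor * (eps / 2 / @norm_factor _ E)) with (eps / 2) in H1
    by (field; lra).
  rewrite -norm_J J_minus norm_minus_sym in H1.
  pose proof (norm_minus_triangle (J E x) (J E y0) z); lra. }
apply (plus_reg_r (opp z)); rewrite plus_opp_r.
exact (norm_eq_zero _ (Rle_antisym _ _ H0 (norm_ge_0 _))).
Qed.

(** The functional [phi o u] has norm at most [op_norm u], so dividing it by
[op_norm u] brings it into the dual ball.  When [op_norm u = 0] it vanishes, and the
coefficient [zero] is used. *)
Lemma dual_ball_pullback {E F : CompleteNormedModule k} (u : E -> F) :
  is_linear u -> forall phi : dual_ball F, exists (c : k * dual_ball E),
    abs (fst c) <= op_norm u /\
    forall x, proj1_sig phi (u x) = mult (fst c) (proj1_sig (snd c) x).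
Proof.
intros Hu [phi [Hphi H1]]; simpl.
assert (Hc : is_linear (fun x => phi (u x))).
{ split.
  - intros x y; rewrite (linear_plus _ Hu); apply (linear_plus _ Hphi).
  - intros a x; rewrite (linear_scal _ Hu); apply (linear_scal _ Hphi).
  - destruct (linear_norm _ Hu) as [M [HM Hb]].
    exists M; split; [exact HM | intros x].
    eapply Rle_trans; [exact (op_norm_ub phi (u x) Hphi) | ].
    eapply Rle_trans; [apply Rmult_le_compat_r; [apply norm_ge_0 | exact H1] | ].
    rewrite Rmult_1_l; apply Hb. }
assert (Hbd : forall x, norm (phi (u x)) <= op_norm u * norm x).
{ intros x; eapply Rle_trans; [exact (op_norm_ub phi (u x) Hphi) | ].
  eapply Rle_trans; [apply Rmult_le_compat_r; [apply norm_ge_0 | exact H1] | ].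
  rewrite Rmult_1_l; apply op_norm_ub; exact Hu. }
destruct (Rle_lt_or_eq_dec _ _ (op_norm_ge0 u Hu)) as [Hpos | H0].
- destruct (scalars_of_pos k _ Hpos) as [a [b [Hab [Ha Hb]]]].
  set (psi := fun x => scal b (phi (u x)) : AbsRing_NormedModule k).
  assert (Hle : forall x, norm (psi x) <= 1 * norm x).
  { intros x; eapply Rle_trans; [apply norm_scal | ]; rewrite Hb.
    eapply Rle_trans;
      [apply Rmult_le_compat_l; [left; apply Rinv_0_lt_compat; exact Hpos | apply Hbd] | ].
    right; field; lra. }
  assert (Hpsi : is_linear psi /\ op_norm psi <= 1).
  { split; [split | apply op_norm_le; [lra | exact Hle]].
    - intros x y; unfold psi; rewrite (linear_plus _ Hc).
      exact (mult_distr_l b (phi (u x)) (phi (u y))).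
    - intros c x; unfold psi; rewrite (linear_scal _ Hc).
      change (mult b (mult c (phi (u x))) = mult c (mult b (phi (u x)))).
      rewrite !mult_assoc (scalars_mult_comm k b c); reflexivity.
    - exists 1; split; [lra | exact Hle]. }
  exists (a, exist _ psi Hpsi); simpl; split; [rewrite Ha; apply Rle_refl | ].
  intros x; unfold psi; change (scal b (phi (u x))) with (mult b (phi (u x))).
  rewrite mult_assoc Hab mult_one_l; reflexivity.
- assert (Hball : op_norm (fun x => phi (u x)) <= 1).
  { apply op_norm_le; [lra | intros x].
    eapply Rle_trans; [apply Hbd | rewrite -H0].
    apply Rmult_le_compat_r; [apply norm_ge_0 | lra]. }
  exists (zero, exist _ (fun x => phi (u x)) (conj Hc Hball)); simpl; split.
  + rewrite abs_zero -H0; apply Rle_refl.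
  + intros x; rewrite mult_zero_l; apply (norm_eq_zero (V := AbsRing_NormedModule k)).
    apply Rle_antisym; [ | apply norm_ge_0].
    pose proof (Hbd x) as H; rewrite -H0 Rmult_0_l in H; exact H.
Qed.

(** For [u] nonzero, the lift takes as coordinate of index [phi] the one of index
[phi o u / op_norm u], multiplied by [op_norm u]. *)
Lemma linear_lift {E F : CompleteNormedModule k} (u : E -> F) :
  is_linear u -> exists v : linf_dual E -> linf_dual F,
    is_linear v /\ op_norm v <= op_norm u /\ forall x, v (J E x) = J F (u x).
Proof.
intros Hu.
destruct (choice _ (dual_ball_pullback u Hu)) as [c Hc].
pose proof (op_norm_ge0 u Hu) as Hu0.
assert (Hb : forall (xi : linf_dual E) phi,
  abs (mult (fst (c phi)) (xi (snd (c phi)))) <= op_norm u * norm xi).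
{ intros xi phi; eapply Rle_trans; [apply abs_mult | ].
  apply Rmult_le_compat; try apply abs_ge_0; [apply Hc | ].
  exact (linf_norm_ub k _ xi (snd (c phi))). }
set (v := fun xi : linf_dual E =>
  Linf (fun phi => mult (fst (c phi)) (xi (snd (c phi))))
    (ex_intro _ _ (Hb xi)) : linf_dual F).
assert (Hv : forall xi, norm (v xi) <= op_norm u * norm xi).
{ intros xi; apply linf_norm_le; [ | exact (Hb xi)].
  apply Rmult_le_pos; [exact Hu0 | apply norm_ge_0]. }
exists v; split; [split | split].
- intros xi eta; apply linf_eq; intros phi; exact (mult_distr_l _ _ _).
- intros a xi; apply linf_eq; intros phi; simpl.
  change (mult (fst (c phi)) (mult a (xi (snd (c phi))))
          = mult a (mult (fst (c phi)) (xi (snd (c phi))))).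
  rewrite !mult_assoc (scalars_mult_comm k a); reflexivity.
- exists (op_norm u + 1); split; [lra | intros xi].
  eapply Rle_trans; [apply Hv | ].
  apply Rmult_le_compat_r; [apply norm_ge_0 | lra].
- apply op_norm_le; [exact Hu0 | exact Hv].
- intros x; apply linf_eq; intros phi; symmetry; exact (proj2 (Hc phi) x).
Qed.

End Embedding.

(** * Lipschitz and two-Lipschitz constants *)

Lemma least_constant_glb (P : R -> Prop) : (exists C, 0 <= C /\ P C) ->
  (forall C, 0 <= C -> P C -> least_constant P <= C) /\
  (forall b, (forall C, 0 <= C -> P C -> b <= C) -> b <= least_constant P).
Proof.
intros HP.
destruct (Glb_Rbar_bounded (fun C => 0 <= C /\ P C) 0 HP) as [H1 H2].
{ intros C [HC _]; exact HC. }
split; [intros C HC HPC; apply H1; auto | ].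
intros b Hb; apply H2; intros C [HC HPC]; auto.
Qed.

Lemma Lip_ge0 {X Y : pointed_metric} (f : X -> Y) : Lip0 f -> 0 <= Lip f.
Proof.
intros [_ Hf]; apply (proj2 (least_constant_glb _ Hf)); intros C HC _; exact HC.
Qed.

Lemma Lip0_id (X : pointed_metric) : Lip0 (fun x : X => x).
Proof.
split; [reflexivity | exists 1; split; [lra | ]].
intros x x'; rewrite Rmult_1_l; apply Rle_refl.
Qed.

Lemma Lip_id_le (X : pointed_metric) : Lip (fun x : X => x) <= 1.
Proof.
apply (proj1 (least_constant_glb _ (proj2 (Lip0_id X)))); [lra | ].
intros x x'; rewrite Rmult_1_l; apply Rle_refl.
Qed.

(** The increment of [T] between the base points and [(x1, x2)] is [T x1 x2].  Every
admissible constant gives the bound, and so does their infimum, which needs care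
only when the product of distances vanishes. *)
Lemma norm_le_BLip {k : scalar_field} {X1 X2 : pointed_metric}
    {E : CompleteNormedModule k} (T : X1 -> X2 -> E) (x1 : X1) (x2 : X2) :
  BLip0 T ->
  norm (T x1 x2) <= BLip T * (dist X1 x1 (base_point X1) * dist X2 x2 (base_point X2)).
Proof.
intros [HT2 [HT1 [C [HC HTC]]]].
set (d := dist X1 x1 (base_point X1) * dist X2 x2 (base_point X2)).
assert (Hd : 0 <= d) by (apply Rmult_le_pos; apply Rge_le, dist_pos).
assert (Hb : forall C, two_lip_bound T C -> norm (T x1 x2) <= C * d).
{ intros D HD; specialize (HD x1 (base_point X1) x2 (base_point X2)).
  rewrite !HT1 !HT2 /minus opp_zero !plus_zero_r Rmult_assoc in HD; exact HD. }
destruct (Rle_lt_or_eq_dec _ _ Hd) as [Hpos | H0].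
- apply (Rmult_le_reg_r (/ d)); [apply Rinv_0_lt_compat; exact Hpos | ].
  rewrite Rmult_assoc (Rinv_r d (Rgt_not_eq _ _ Hpos)) Rmult_1_r.
  apply least_constant_glb; [exists C; split; [lra | exact HTC] | ].
  intros D _ HD; apply (Rmult_le_reg_r d); [exact Hpos | ].
  rewrite Rmult_assoc (Rinv_l d (Rgt_not_eq _ _ Hpos)) Rmult_1_r; apply Hb; exact HD.
- pose proof (Hb C HTC) as H; rewrite -H0 !Rmult_0_r in H |- *; exact H.
Qed.

Lemma two_lip_bound_J {k : scalar_field} {X1 X2 : pointed_metric}
    {E : CompleteNormedModule k} (T : X1 -> X2 -> E) (C : R) :
  two_lip_bound (fun x1 x2 => J E (T x1 x2)) C <-> two_lip_bound T C.
Proof.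
split; intros H x1 x1' x2 x2'; specialize (H x1 x1' x2 x2').
- rewrite -!J_minus -J_plus norm_J in H; exact H.
- rewrite -!J_minus -J_plus norm_J; exact H.
Qed.

Lemma BLip_J {k : scalar_field} {X1 X2 : pointed_metric}
    {E : CompleteNormedModule k} (T : X1 -> X2 -> E) :
  BLip (fun x1 x2 => J E (T x1 x2)) = BLip T.
Proof.
unfold BLip, least_constant; f_equal; apply Glb_Rbar_eqset; intros C.
rewrite two_lip_bound_J; reflexivity.
Qed.

Lemma J_eq_zero {k : scalar_field} {E : CompleteNormedModule k} (y : E) :
  J E y = zero -> y = zero.
Proof.
intros H; refine (norm_eq_zero y _); rewrite -norm_J H; exact norm_zero.
Qed.

Lemma BLip0_J {k : scalar_field} {X1 X2 : pointed_metric}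
    {E : CompleteNormedModule k} (T : X1 -> X2 -> E) :
  BLip0 (fun x1 x2 => J E (T x1 x2)) -> BLip0 T.
Proof.
intros [H2 [H1 [C [HC HTC]]]].
split; [ | split; [ | exists C; split; [exact HC | apply two_lip_bound_J, HTC]]];
  intros x; apply J_eq_zero; auto.
Qed.

(** * The injective hull *)

Section Hull.

Context {k : scalar_field} {I : two_lip_class k} {nI : two_lip_norm k}.

(** Membership in [I] of any map that agrees pointwise with [J o T] suffices: the
two-Lipschitz condition on [T] is inherited from that map, as [J E] is an
isometry. *)
Lemma inj_hull_intro {X1 X2 : pointed_metric} {E : CompleteNormedModule k}
    (T : X1 -> X2 -> E) (S : X1 -> X2 -> linf_dual E) :
  is_two_lip_ideal I -> I X1 X2 (linf_dual E) S ->
  (forall x1 x2, J E (T x1 x2) = S x1 x2) -> inj_hull I X1 X2 E T.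
Proof.
intros HI HS HTS.
assert (HT : I X1 X2 (linf_dual E) (fun x1 x2 => J E (T x1 x2))).
{ replace (fun x1 x2 => J E (T x1 x2)) with S; [exact HS | ].
  do 2 (apply functional_extensionality; intro); symmetry; apply HTS. }
split; [apply BLip0_J, (ideal_BLip0 I HI), HT | exact HT].
Qed.

Lemma inj_hull_norm_eq {X1 X2 : pointed_metric} {E : CompleteNormedModule k}
    (T : X1 -> X2 -> E) (S : X1 -> X2 -> linf_dual E) :
  (forall x1 x2, J E (T x1 x2) = S x1 x2) ->
  inj_hull_norm nI X1 X2 E T = nI X1 X2 (linf_dual E) S.
Proof.
intros HTS; unfold inj_hull_norm; f_equal.
do 2 (apply functional_extensionality; intro); apply HTS.
Qed.

Lemma ideal_incl_inj_hull {X1 X2 : pointed_metric} {E : CompleteNormedModule k}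
    (T : X1 -> X2 -> E) :
  is_two_lip_ideal I -> I X1 X2 E T -> inj_hull I X1 X2 E T.
Proof.
intros HI HT; split; [apply (ideal_BLip0 I HI), HT | ].
exact (ideal_comp I HI X1 X2 X1 X2 E _ _ _ T (J E)
         (Lip0_id X1) (Lip0_id X2) HT (J_linear E)).
Qed.

Lemma inj_hull_ideal : is_two_lip_ideal I -> is_two_lip_ideal (inj_hull I).
Proof.
intros HI; split.
- intros X1 X2 E T [HT _]; exact HT.
- intros X1 X2 E; apply ideal_incl_inj_hull; [exact HI | apply (ideal_zero I HI)].
- intros X1 X2 E S T [_ HS] [_ HT].
  apply (inj_hull_intro _ _ HI (ideal_plus I HI _ _ _ _ _ HS HT)).
  intros x1 x2; apply J_plus.
- intros X1 X2 E a T [_ HT].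
  apply (inj_hull_intro _ _ HI (ideal_scal I HI _ _ _ a _ HT)).
  intros x1 x2; apply J_scal.
- intros X1 X2 E f1 f2 e Hf1 Hf2; apply ideal_incl_inj_hull; [exact HI | ].
  apply (ideal_rank_one I HI); assumption.
- intros X1 X2 Z W E F f1 f2 T u Hf1 Hf2 [_ HT] Hu.
  destruct (linear_lift u Hu) as [v [Hv [_ Hvu]]].
  apply (inj_hull_intro _ _ HI
           (ideal_comp I HI _ _ _ _ _ _ f1 f2 _ v Hf1 Hf2 HT Hv)).
  intros z w; symmetry; apply Hvu.
Qed.

(** The product of scalars has rank one: it is built from two identity maps and the
vector [one]. *)
Lemma ideal_mult : is_two_lip_ideal I ->
  I (scalar_pointed k) (scalar_pointed k) (scalar_space k) (fun a b : k => mult a b).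
Proof.
intros HI.
replace (fun a b : k => mult a b)
  with (fun a b : k => scal (mult a b) (one : k) : scalar_space k).
- apply (ideal_rank_one I HI (scalar_pointed k) (scalar_pointed k) (scalar_space k)
           (fun a => a) (fun b => b)); apply (Lip0_id (scalar_pointed k)).
- do 2 (apply functional_extensionality; intro); apply (mult_one_r (K := k)).
Qed.

(** Composition on the left alone is the ideal inequality with identity maps as the
two Lipschitz factors; [Lip] of the identity may be [0], on a one-point space. *)
Lemma normed_comp_linear (HI : is_normed_two_lip_ideal I nI)
    {X1 X2 : pointed_metric} {E F : CompleteNormedModule k}
    (T : X1 -> X2 -> E) (u : E -> F) (M : R) :
  I X1 X2 E T -> is_linear u -> op_norm u <= M ->
  nI X1 X2 F (fun x1 x2 => u (T x1 x2)) <= M * nI X1 X2 E T.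
Proof.
intros HT Hu HM.
pose proof (normed_ge0 I nI HI _ _ _ T HT) as HT0.
pose proof (op_norm_ge0 u Hu) as Hu0.
assert (H : forall a c, 0 <= a -> c <= 1 -> a * c <= a)
  by (intros a c Ha Hc; rewrite -{2}(Rmult_1_r a); apply Rmult_le_compat_l; assumption).
eapply Rle_trans;
  [exact (normed_comp I nI HI _ _ X1 X2 _ _ _ _ T u (Lip0_id X1) (Lip0_id X2) HT Hu) | ].
eapply Rle_trans; [apply H; [ | apply Lip_id_le] | ].
- repeat apply Rmult_le_pos; try assumption; apply Lip_ge0, Lip0_id.
- eapply Rle_trans; [apply H; [ | apply Lip_id_le] | ].
  + apply Rmult_le_pos; assumption.
  + apply Rmult_le_compat_r; assumption.
Qed.

Lemma id_in_dual_ball : exists phi : dual_ball (scalar_space k),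
  forall a, proj1_sig phi a = a.
Proof.
assert (H : forall a : scalar_space k, norm (a : AbsRing_NormedModule k) <= 1 * norm a)
  by (intros a; rewrite Rmult_1_l; apply Rle_refl).
unshelve eexists (exist _ (fun a : scalar_space k => a : AbsRing_NormedModule k) _);
  [ | reflexivity].
split; [split; [reflexivity | reflexivity | exists 1; split; [lra | exact H]] | ].
apply op_norm_le; [lra | exact H].
Qed.

Lemma linf_eval_linear {E : CompleteNormedModule k} (phi : dual_ball E) :
  is_linear (fun xi : linf_dual E => xi phi : scalar_space k) /\
  op_norm (fun xi : linf_dual E => xi phi : scalar_space k) <= 1.
Proof.
assert (H : forall xi : linf_dual E, abs (xi phi) <= 1 * norm xi)
  by (intros xi; rewrite Rmult_1_l; apply (linf_norm_ub k _ xi)).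
split; [split; [reflexivity | reflexivity | exists 1; split; [lra | exact H]] | ].
apply op_norm_le; [lra | exact H].
Qed.

(** Composing with [J] does not increase the norm, and neither does the evaluation
at the identity functional, which undoes [J]. *)
Lemma inj_hull_norm_mult : is_normed_two_lip_ideal I nI ->
  inj_hull_norm nI (scalar_pointed k) (scalar_pointed k) (scalar_space k)
    (fun a b : k => mult a b) = 1.
Proof.
intros HI.
pose proof (ideal_mult (normed_ideal I nI HI)) as Hid.
pose proof (normed_Id I nI HI) as H1.
destruct (ideal_incl_inj_hull _ (normed_ideal I nI HI) Hid) as [_ HJ].
apply Rle_antisym.
- pose proof (normed_comp_linear HI _ (J (scalar_space k)) 1 Hid (J_linear _)
                (op_norm_J _)) as H.
  rewrite H1 Rmult_1_l in H; exact H.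
- destruct id_in_dual_ball as [phi Hphi].
  destruct (linf_eval_linear phi) as [Hlin Hnorm].
  pose proof (normed_comp_linear HI _ _ 1 HJ Hlin Hnorm) as H.
  rewrite Rmult_1_l in H; refine (Rle_trans _ _ _ _ H); rewrite -H1; right; f_equal.
  do 2 (apply functional_extensionality; intro); symmetry; apply Hphi.
Qed.

Lemma inj_hull_normed : is_normed_two_lip_ideal I nI ->
  is_normed_two_lip_ideal (inj_hull I) (inj_hull_norm nI).
Proof.
intros HI; split.
- apply inj_hull_ideal, (normed_ideal I nI HI).
- intros X1 X2 E T [_ HT]; exact (normed_ge0 I nI HI _ _ _ _ HT).
- intros X1 X2 E T [_ HT] H0 x1 x2.
  apply J_eq_zero, (normed_eq0 I nI HI _ _ _ _ HT H0).
- intros X1 X2 E a T [_ HT].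
  rewrite (inj_hull_norm_eq _ (fun x1 x2 => scal a (J E (T x1 x2))));
    [ | intros; apply J_scal].
  exact (normed_scal I nI HI _ _ _ a _ HT).
- intros X1 X2 E S T [_ HS] [_ HT].
  rewrite (inj_hull_norm_eq _ (fun x1 x2 => plus (J E (S x1 x2)) (J E (T x1 x2))));
    [ | intros; apply J_plus].
  exact (normed_triangle I nI HI _ _ _ _ _ HS HT).
- intros X1 X2 E T [_ HT]; rewrite -BLip_J; exact (normed_BLip I nI HI _ _ _ _ HT).
- exact (inj_hull_norm_mult HI).
- intros X1 X2 Z W E F f1 f2 T u Hf1 Hf2 [_ HT] Hu.
  destruct (linear_lift u Hu) as [v [Hv [Hvn Hvu]]].
  rewrite (inj_hull_norm_eq _ (fun z w => v (J E (T (f1 z) (f2 w)))));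
    [ | intros; symmetry; apply Hvu].
  eapply Rle_trans; [exact (normed_comp I nI HI _ _ _ _ _ _ f1 f2 _ v Hf1 Hf2 HT Hv) | ].
  apply Rmult_le_compat_r; [apply Lip_ge0; exact Hf2 | ].
  apply Rmult_le_compat_r; [apply Lip_ge0; exact Hf1 | ].
  apply Rmult_le_compat_r; [exact (normed_ge0 I nI HI _ _ _ _ HT) | exact Hvn].
Qed.

Lemma ideal_minus {X1 X2 : pointed_metric} {E : CompleteNormedModule k}
    (S T : X1 -> X2 -> E) :
  is_two_lip_ideal I -> I X1 X2 E S -> I X1 X2 E T ->
  I X1 X2 E (fun x1 x2 => minus (S x1 x2) (T x1 x2)).
Proof.
intros HI HS HT.
replace (fun x1 x2 => minus (S x1 x2) (T x1 x2))
  with (fun x1 x2 => plus (S x1 x2) (scal (opp one) (T x1 x2))).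
- apply (ideal_plus I HI); [exact HS | apply (ideal_scal I HI); exact HT].
- do 2 (apply functional_extensionality; intro); unfold minus; f_equal.
  apply (scal_opp_one (V := NormedModule.ModuleSpace k E)).
Qed.

Lemma ideal_norm_cvg_pointwise (HI : is_normed_two_lip_ideal I nI)
    {X1 X2 : pointed_metric} {E : CompleteNormedModule k}
    (T : nat -> X1 -> X2 -> E) (S : X1 -> X2 -> E) :
  (forall n, I X1 X2 E (T n)) -> I X1 X2 E S ->
  (forall eps, 0 < eps -> exists N, forall n, (N <= n)%nat ->
     nI X1 X2 E (fun x1 x2 => minus (T n x1 x2) (S x1 x2)) < eps) ->
  forall x1 x2 eps, 0 < eps -> exists N, forall n, (N <= n)%nat ->
    norm (minus (T n x1 x2) (S x1 x2)) < eps.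
Proof.
intros HT HS Hcvg x1 x2 eps He.
set (d := dist X1 x1 (base_point X1) * dist X2 x2 (base_point X2)).
assert (Hd : 0 <= d) by (apply Rmult_le_pos; apply Rge_le, dist_pos).
destruct (Hcvg (eps / (d + 1))) as [N HN]; [apply Rdiv_lt_0_compat; lra | ].
exists N; intros n Hn; specialize (HN n Hn).
pose proof (ideal_minus _ _ (normed_ideal I nI HI) (HT n) HS) as HD.
eapply Rle_lt_trans;
  [exact (norm_le_BLip _ x1 x2 (ideal_BLip0 I (normed_ideal I nI HI) _ _ _ _ HD)) | ].
fold d.
pose proof (normed_BLip I nI HI _ _ _ _ HD) as HB.
apply Rle_lt_trans with (eps / (d + 1) * d).
- apply Rmult_le_compat_r; [exact Hd | lra].
- assert (H : eps / (d + 1) * (d + 1) = eps) by (field; lra).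
  assert (0 < eps / (d + 1)) by (apply Rdiv_lt_0_compat; lra).
  lra.
Qed.

Lemma inj_hull_complete : is_normed_two_lip_ideal I nI ->
  two_lip_components_complete I nI ->
  two_lip_components_complete (inj_hull I) (inj_hull_norm nI).
Proof.
intros HI Hcomplete X1 X2 E T HT Hcauchy.
destruct (Hcomplete X1 X2 (linf_dual E) (fun n x1 x2 => J E (T n x1 x2)))
  as [S' [HS' Hlim]].
- intros n; apply (HT n).
- intros eps He; destruct (Hcauchy eps He) as [N HN].
  exists N; intros n m Hn Hm; specialize (HN n m Hn Hm).
  rewrite (inj_hull_norm_eq _
    (fun x1 x2 => minus (J E (T n x1 x2)) (J E (T m x1 x2)))) in HN;
    [exact HN | intros; apply J_minus].
- assert (HS : forall x1, exists f : X2 -> E, forall x2, J E (f x2) = S' x1 x2).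
  { intros x1; apply (choice (fun x2 y => J E y = S' x1 x2)); intros x2.
    apply (J_range_closed (fun n => T n x1 x2)).
    apply (ideal_norm_cvg_pointwise HI (fun n x1 x2 => J E (T n x1 x2)) S');
      [intros n; apply (HT n) | exact HS' | exact Hlim]. }
  destruct (choice _ HS) as [S HJS].
  exists S; split; [exact (inj_hull_intro S S' (normed_ideal I nI HI) HS' HJS) | ].
  intros eps He; destruct (Hlim eps He) as [N HN]; exists N; intros n Hn.
  rewrite (inj_hull_norm_eq _ (fun x1 x2 => minus (J E (T n x1 x2)) (S' x1 x2)));
    [exact (HN n Hn) | intros; rewrite J_minus HJS; reflexivity].
Qed.

End Hull.

Theorem proposition3p6 (k : scalar_field) (I : two_lip_class k) (nI : two_lip_norm k) :
  (is_normed_two_lip_ideal I nI ->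
   is_normed_two_lip_ideal (inj_hull I) (inj_hull_norm nI)) /\
  (is_banach_two_lip_ideal I nI ->
   is_banach_two_lip_ideal (inj_hull I) (inj_hull_norm nI)).
Proof.
split; [exact inj_hull_normed | ].
intros [HI Hcomplete]; split.
- exact (inj_hull_normed HI).
- exact (inj_hull_complete HI Hcomplete).
Qed.
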